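(* Let $\overline{p}_n^{(q)}$ (resp. $\overline{p}_n^{(t)}$) be the number of asymmetric parallelogram polyominoes of area (resp. half-perimeter) $n$, and let $p_n^{(q)}$ (resp. $p_n^{(t)}$) be the number of all parallelogram polyominoes of area (resp. half-perimeter) $n$. Then, as $n\to\infty$, $$\overline{p}_n^{(q)}\sim p_n^{(q)}\qquad\text{and}\qquad\overline{p}_n^{(t)}\sim p_n^{(t)}.$$
   Context: A parallelogram polyomino is a finite nonempty connected set of unit cells of the square lattice, considered up to translation, whose intersection with every row and every column of cells is a contiguous block (or empty), and which contains the bottom-left and the top-right cells of its minimal bounding rectangle. Equivalently, with columns numbered $1,\dots,w$ from left to right, column $i$ occupies the rows $b_i,\dots,t_i$ with $b_i\le b_{i+1}\le t_i\le t_{i+1}$ for $1\le i<w$. The half-perimeter is the sum of the width and the height of the minimal bounding rectangle; the area is the number of cells. The group $\mathfrak{D}_2=\{1,r^2,d_1,d_2\}$ consists of the identity, the rotation $r^2$ by $180^\circ$, and the reflections $d_1$, $d_2$ about lines parallel to the bisector of the second quadrant ($y=-x$) and of the first quadrant ($y=x$) respectively. A parallelogram polyomino is asymmetric if no element of $\mathfrak{D}_2$ other than the identity maps it to itself (up to translation). Here $a_n\sim b_n$ means $a_n/b_n\to1$ as $n\to\infty$. *)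

(* Defs.v *)
From mathcomp Require Import all_boot all_order all_algebra finmap boolp.
From mathcomp Require Import zify lra.

Set Implicit Arguments.
Unset Strict Implicit.
Unset Printing Implicit Defensive.

Import Order.TTheory GRing.Theory Num.Theory.

Local Open Scope fset_scope.
Local Open Scope ring_scope.

(* A unit cell of the square lattice is named by its column and its row. *)
Definition cell : choiceType := (int * int)%type.

Definition translate (v : int * int) (P : {fset cell}) : {fset cell} :=
  [fset ((c.1 + v.1, c.2 + v.2) : cell) | c in P].

Definition translates (P Q : {fset cell}) : Prop :=
  exists v : int * int, Q = translate v P.

Definition adjacent (c d : cell) : bool := `|c.1 - d.1| + `|c.2 - d.2| == 1.

Definition connected (P : {fset cell}) : Prop :=
  forall c d : P, connect (fun u v : P => adjacent (val u) (val v)) c d.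

Definition row_convex (P : {fset cell}) : Prop :=
  forall x1 x2 x3 y : int, x1 <= x2 -> x2 <= x3 ->
    (x1, y) \in P -> (x3, y) \in P -> (x2, y) \in P.

Definition column_convex (P : {fset cell}) : Prop :=
  forall x y1 y2 y3 : int, y1 <= y2 -> y2 <= y3 ->
    (x, y1) \in P -> (x, y3) \in P -> (x, y2) \in P.

(* The value on the empty sequence is irrelevant: only nonempty sets of cells
   are ever considered. *)
Definition mins (s : seq int) : int := foldr Order.min (head 0 s) s.
Definition maxs (s : seq int) : int := foldr Order.max (head 0 s) s.

Definition xmin (P : {fset cell}) : int := mins [seq c.1 | c <- P].
Definition xmax (P : {fset cell}) : int := maxs [seq c.1 | c <- P].
Definition ymin (P : {fset cell}) : int := mins [seq c.2 | c <- P].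
Definition ymax (P : {fset cell}) : int := maxs [seq c.2 | c <- P].

Definition parallelogram_polyomino (P : {fset cell}) : Prop :=
  [/\ P != fset0, connected P, row_convex P /\ column_convex P,
      (xmin P, ymin P) \in P & (xmax P, ymax P) \in P].

Definition area (P : {fset cell}) : nat := #|` P|.

Definition width (P : {fset cell}) : int := xmax P - xmin P + 1.
Definition height (P : {fset cell}) : int := ymax P - ymin P + 1.
Definition half_perimeter (P : {fset cell}) : nat := absz (width P + height P).

(* The action on cell centres, with the centre of the cell (0, 0) as origin;
   another choice of centre or of parallel axes changes the images by a
   translation only. *)
Definition r2 (c : cell) : cell := (- c.1, - c.2).
Definition d1 (c : cell) : cell := (- c.2, - c.1).
Definition d2 (c : cell) : cell := (c.2, c.1).

Definition asymmetric (P : {fset cell}) : Prop :=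
  [/\ ~ translates P [fset r2 c | c in P],
      ~ translates P [fset d1 c | c in P] &
      ~ translates P [fset d2 c | c in P]].

(* Polyominoes up to translation are counted through the unique translate whose
   bounding rectangle has (0, 0) as its bottom-left cell (translates_placed and
   placed_unique below).  Those of area or half-perimeter n all lie in box n
   (area_box and half_perimeter_box below), which makes the counts finite. *)
Definition placed (P : {fset cell}) : Prop := xmin P = 0 /\ ymin P = 0.

Definition box (n : nat) : {fset cell} :=
  [fset ((i%:Z, j%:Z) : cell) | i in iota 0 n, j in iota 0 n].

Definition count_placed (n : nat) (C : {fset cell} -> Prop) : nat :=
  #|` [fset P in fpowerset (box n) | `[< placed P /\ C P >]] |.

Definition p_area (n : nat) : nat :=
  count_placed n (fun P => parallelogram_polyomino P /\ area P = n).

Definition asym_p_area (n : nat) : nat :=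
  count_placed n (fun P =>
    [/\ parallelogram_polyomino P, asymmetric P & area P = n]).

Definition p_half_perimeter (n : nat) : nat :=
  count_placed n (fun P => parallelogram_polyomino P /\ half_perimeter P = n).

Definition asym_p_half_perimeter (n : nat) : nat :=
  count_placed n (fun P =>
    [/\ parallelogram_polyomino P, asymmetric P & half_perimeter P = n]).

Lemma mins_le (s : seq int) x : x \in s -> mins s <= x.
Proof.
rewrite /mins; move: (head 0 s) => h; elim: s => //= y s IH.
by rewrite inE ge_min => /orP[/eqP->|/IH ->]; rewrite ?lexx ?orbT.
Qed.

Lemma maxs_ge (s : seq int) x : x \in s -> x <= maxs s.
Proof.
rewrite /maxs; move: (head 0 s) => h; elim: s => //= y s IH.
by rewrite inE le_max => /orP[/eqP->|/IH ->]; rewrite ?lexx ?orbT.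
Qed.

Lemma mins_mem (s : seq int) : s != [::] -> mins s \in s.
Proof.
case: s => // y s _; rewrite /mins; set h := head 0 _.
have hs : h \in y :: s by rewrite inE eqxx.
have H t : foldr Order.min h t \in h :: t.
  elim: t => [|z t IH] /=; first by rewrite inE.
  by rewrite minEle; case: ifP => _; rewrite !inE ?eqxx ?orbT //;
     move: IH; rewrite inE => /orP[->|->]; rewrite ?orbT.
by move: (H (y :: s)); rewrite inE => /orP[/eqP->|].
Qed.

Lemma maxs_mem (s : seq int) : s != [::] -> maxs s \in s.
Proof.
case: s => // y s _; rewrite /maxs; set h := head 0 _.
have hs : h \in y :: s by rewrite inE eqxx.
have H t : foldr Order.max h t \in h :: t.
  elim: t => [|z t IH] /=; first by rewrite inE.
  by rewrite maxEle; case: ifP => _; rewrite !inE ?eqxx ?orbT //;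
     move: IH; rewrite inE => /orP[->|->]; rewrite ?orbT.
by move: (H (y :: s)); rewrite inE => /orP[/eqP->|].
Qed.

Lemma fset_map_nil (P : {fset cell}) (f : cell -> int) :
  P != fset0 -> [seq f c | c <- P] != [::].
Proof.
move=> /fset0Pn[c cP]; apply/negP => /eqP E.
have : f c \in [seq f c | c <- P] by apply: map_f.
by rewrite E.
Qed.

Lemma mem_translate v (P : {fset cell}) (c : cell) :
  (c \in translate v P) = (((c.1 - v.1, c.2 - v.2) : cell) \in P).
Proof.
apply/imfsetP/idP => [[d /= dP ->] /=|cP].
  by rewrite !addrK -surjective_pairing.
by exists (c.1 - v.1, c.2 - v.2) => //=; rewrite !subrK -surjective_pairing.
Qed.

Lemma translate_neq0 v (P : {fset cell}) :
  P != fset0 -> translate v P != fset0.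
Proof.
move=> /fset0Pn[c cP]; apply/fset0Pn; exists (c.1 + v.1, c.2 + v.2).
by rewrite mem_translate /= !addrK -surjective_pairing.
Qed.

Lemma xmin_translate v (P : {fset cell}) :
  P != fset0 -> xmin (translate v P) = xmin P + v.1.
Proof.
move=> P0; apply/eqP; rewrite eq_le; apply/andP; split.
  have /mapP[c cP E] := mins_mem (fset_map_nil fst P0).
  rewrite /xmin E; apply: mins_le; apply/mapP.
  by exists (c.1 + v.1, c.2 + v.2) => //;
     rewrite mem_translate /= !addrK -surjective_pairing.
have /mapP[c cP E] := mins_mem (fset_map_nil fst (translate_neq0 v P0)).
rewrite [leRHS]E -lerBrDr; apply: mins_le; apply/mapP.
by exists (c.1 - v.1, c.2 - v.2) => //; rewrite -mem_translate.
Qed.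

Lemma ymin_translate v (P : {fset cell}) :
  P != fset0 -> ymin (translate v P) = ymin P + v.2.
Proof.
move=> P0; apply/eqP; rewrite eq_le; apply/andP; split.
  have /mapP[c cP E] := mins_mem (fset_map_nil snd P0).
  rewrite /ymin E; apply: mins_le; apply/mapP.
  by exists (c.1 + v.1, c.2 + v.2) => //;
     rewrite mem_translate /= !addrK -surjective_pairing.
have /mapP[c cP E] := mins_mem (fset_map_nil snd (translate_neq0 v P0)).
rewrite [leRHS]E -lerBrDr; apply: mins_le; apply/mapP.
by exists (c.1 - v.1, c.2 - v.2) => //; rewrite -mem_translate.
Qed.

Lemma translates_placed (P : {fset cell}) : P != fset0 ->
  exists2 Q, translates P Q & placed Q.
Proof.
move=> P0; exists (translate (- xmin P, - ymin P) P).
  by exists (- xmin P, - ymin P).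
by rewrite /placed xmin_translate // ymin_translate //= !subrr.
Qed.

Lemma placed_unique (P Q : {fset cell}) : P != fset0 ->
  placed P -> placed Q -> translates P Q -> P = Q.
Proof.
move=> P0 [xP yP] [xQ yQ] [v E].
move: xQ yQ; rewrite E xmin_translate // ymin_translate // xP yP !add0r.
move=> v1 v2; apply/fsetP => c.
by rewrite mem_translate v1 v2 !subr0 -surjective_pairing.
Qed.

Section Spread.
Variable f : cell -> int.
Hypothesis f_adj : forall c d, adjacent c d -> `|f c - f d| <= 1.

Lemma path_spread (P : {fset cell}) (s : seq P) (c : P) (x : int) :
  path (fun u v : P => adjacent (val u) (val v)) c s ->
  f (val c) <= x -> x <= f (val (last c s)) ->
  exists2 d : P, d \in c :: s & f (val d) = x.
Proof.
elim: s c => [|e s IH] c /=.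
  by move=> _ cx xc; exists c; rewrite ?mem_head //; apply/eqP; rewrite eq_le cx xc.
move=> /andP[/f_adj ce es] cx xl.
have [ex|xe] := lerP (f (val e)) x.
  by have [d ds <-] := IH e es ex xl; exists d; rewrite // inE ds orbT.
exists c; first by rewrite mem_head.
by move: xe => /= xe; lia.
Qed.

Lemma connected_spread (P : {fset cell}) (c d : cell) :
  connected P -> c \in P -> d \in P -> f d - f c < (#|` P|)%:Z.
Proof.
move=> conP cP dP.
have [lt|le] := ltrP (f d) (f c).
  have : (0 <= #|` P|%:Z)%R by []. lia.
have /connectP[s sP ds] := conP [` cP] [` dP].
have sub : {subset [seq f c + i%:Z | i <- iota 0 `|f d - f c|.+1] <=
             [fset f e | e in P]}.
  move=> x /mapP[i]; rewrite mem_iota => /andP[_ hi] ->.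
  have [| |e _ <-] := path_spread (x := f c + i%:Z) sP; rewrite -?ds /=; try lia.
  by apply/imfsetP; exists (val e) => //=; apply: valP.
have := uniq_leq_size _ sub; rewrite map_inj_uniq ?iota_uniq; last first.
  by move=> i j; lia.
move/(_ isT); rewrite size_map size_iota => h.
have := leq_trans h (leq_imfset_card _ _ _) => /=; lia.
Qed.
End Spread.

Lemma adjacent1 c d : adjacent c d -> `|c.1 - d.1| <= 1.
Proof. rewrite /adjacent; lia. Qed.

Lemma adjacent2 c d : adjacent c d -> `|c.2 - d.2| <= 1.
Proof. rewrite /adjacent; lia. Qed.

Lemma in_box n (c : cell) : 0 <= c.1 < n%:Z -> 0 <= c.2 < n%:Z -> c \in box n.
Proof.
case: c => x y /= hx hy; apply/imfset2P; exists `|x|%N; first by rewrite /= mem_iota; lia.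
by exists `|y|%N; rewrite /= ?mem_iota; [lia|congr pair; lia].
Qed.

Lemma bounds (P : {fset cell}) (c : cell) : c \in P ->
  xmin P <= c.1 <= xmax P /\ ymin P <= c.2 <= ymax P.
Proof.
move=> cP; have c1P : c.1 \in [seq c.1 | c <- P] by apply: (map_f fst).
have c2P : c.2 \in [seq c.2 | c <- P] by apply: (map_f snd).
by rewrite /xmin /xmax /ymin /ymax !mins_le ?maxs_ge.
Qed.

Lemma area_box n (P : {fset cell}) :
  placed P -> parallelogram_polyomino P -> area P = n -> P `<=` box n.
Proof.
move=> [xP yP] [_ conP _ oP _] <-; rewrite xP yP in oP.
apply/fsubsetP => c cP.
have := connected_spread adjacent1 conP oP cP.
have := connected_spread adjacent2 conP oP cP.
have [] := bounds cP.
rewrite xP yP /= !subr0 => /andP[x0 _] /andP[y0 _] yn xn.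
by apply: in_box; rewrite ?x0 ?y0.
Qed.

Lemma half_perimeter_box n (P : {fset cell}) :
  placed P -> parallelogram_polyomino P -> half_perimeter P = n ->
  P `<=` box n.
Proof.
move=> [xP yP] _ <-; apply/fsubsetP => c /bounds[].
by rewrite /half_perimeter /width /height xP yP => *; apply: in_box; lia.
Qed.

(* Main.v *)
From mathcomp Require Import all_boot all_order all_algebra.
From mathcomp Require Import all_classical all_reals all_analysis.
From mathcomp Require Import finmap zify.
Require Import Defs.

(** Symmetric parallelogram polyominoes are exponentially rare because such a
    polyomino is determined by one half of itself, and halves of different
    symmetric polyominoes can be recombined freely.

    Place the polyomino with its bounding rectangle [[0, a] x [0, b]] at the
    origin.  The symmetry in question then becomes an explicit involution of
    the plane ([mirror]), and the plane splits into a half and its image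
    overlapping in few cells: along the main diagonal for the reflection [d2],
    along the central antidiagonal for [r2] and [d1] ([lower_half]).  If [P]
    and [Q] have the same symmetry and rectangle and agree on the overlap,
    then the half of [P] together with the complementary part of [Q] is again
    a parallelogram polyomino, of the same half-perimeter, and of the same area
    if the areas of [P] and [Q] are equal; both [P] and [Q] can be read off
    from it.  So a class [S] of symmetric
    polyominoes agreeing in these data satisfies [|S|^2 <= p_n]
    ([glue_square]).  The cells of a polyomino on an antidiagonal are
    consecutive, hence given by two endpoints, and polynomially many classes
    suffice: the number [s_n] of polyominoes with some symmetry satisfies
    [s_n^2 <= C n^8 p_n] ([symmetric_square]).

    On the other hand [p_(n+1) >= 2 p_n], since a cell can be attached on the
    right of the top-right cell or above it ([polyominoes_double]).  Thus [p_n]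
    grows at least like [2^n] and [(s_n / p_n)^2 <= C n^8 / p_n] tends to [0].

    That the recombined set is a polyomino is transparent because
    parallelogram polyominoes have a description by conditions each involving
    only two consecutive antidiagonals ([staircase]). *)

Set Implicit Arguments.
Unset Strict Implicit.
Unset Printing Implicit Defensive.

Import Order.TTheory GRing.Theory Num.Theory.
Import numFieldNormedType.Exports.
Local Open Scope fset_scope.
Local Open Scope ring_scope.

(** * A local description of parallelogram polyominoes *)

(** Parallelogram polyominoes with bounding rectangle [[0, a] x [0, b]],
    described locally: connectivity and convexity are replaced by conditions
    on neighbouring cells, which survive cutting and gluing. *)
Record staircase (a b : int) (P : {fset cell}) : Prop := Staircase {
  stair_box : forall x y : int, (x, y) \in P -> 0 <= x <= a /\ 0 <= y <= b;
  stair_bottom_left : (0, 0) \in P;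
  stair_top_right : (a, b) \in P;
  stair_parent : forall x y : int, (x, y) \in P -> 0 < x + y ->
    (x - 1, y) \in P \/ (x, y - 1) \in P;
  stair_corner : forall x y : int, (x, y + 1) \in P -> (x + 1, y) \in P ->
    (x + 1, y + 1) \in P }.

Lemma connected_closed (P : {fset cell}) (I : pred cell) (c d : cell) :
  connected P -> c \in P -> d \in P ->
  (forall u v, u \in P -> v \in P -> adjacent u v -> I u -> I v) ->
  I c -> I d.
Proof.
move=> conP cP dP clI Ic; have /connectP[s sP /(congr1 val) /= ->] := conP [` cP] [` dP].
have : I (val [` cP]) by [].
elim: s [` cP] sP {Ic} => //= e s IH f /andP[fe es] If.
by apply: IH es _; apply: clI fe If; apply: valP.
Qed.

(** Both local conditions hold for the same reason.  If one fails, row and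
    column convexity empty two perpendicular rays bounding a quadrant; the
    open quadrant then contains a corner cell of the rectangle, is cut off
    from the rest, and misses another cell, against connectivity. *)
Lemma staircase_of_polyomino (P : {fset cell}) : placed P ->
  parallelogram_polyomino P -> staircase (xmax P) (ymax P) P.
Proof.
move=> [xP yP] [_ conP [rowP colP] oP tP]; rewrite xP yP in oP.
have boxP x y : (x, y) \in P -> 0 <= x <= xmax P /\ 0 <= y <= ymax P.
  by move=> /bounds; rewrite xP yP.
split=> // x y xyP; last first.
  (* The corner condition: the quadrant of (x + 1, y + 1) holds the top-right
     cell but not (x, y + 1). *)
  move=> xyP'; apply/negPn/negP => cN.
  have rN z : x < z -> (z, y + 1) \notin P.
    move=> xz; apply/negP => zP; case/negP: cN.
    by apply: (rowP x (x + 1) z) => //; lia.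
  have uN z : y < z -> (x + 1, z) \notin P.
    move=> xz; apply/negP => zP; case/negP: cN.
    by apply: (colP (x + 1) y (y + 1) z) => //; lia.
  have [hx _] := boxP _ _ xyP'; have [_ hy] := boxP _ _ xyP.
  have tx : xmax P <> x + 1.
    by move=> E; move: (uN (ymax P)); rewrite -E tP => H; have := H ltac:(lia).
  have ty : ymax P <> y + 1.
    by move=> E; move: (rN (xmax P)); rewrite -E tP => H; have := H ltac:(lia).
  have := connected_closed (I := fun c => (x + 1 < c.1) && (y + 1 < c.2)) conP tP xyP.
  move=> /=; suff cl : forall u v, u \in P -> v \in P -> adjacent u v ->
      (x + 1 < u.1) && (y + 1 < u.2) -> (x + 1 < v.1) && (y + 1 < v.2).
    by move=> /(_ cl); lia.
  move=> [u1 u2] [v1 v2] _ vP; rewrite /adjacent /= => uv hu.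
  have [E|nx] := eqVneq v1 (x + 1).
    by move: (uN v2); rewrite -E vP => H; have := H ltac:(lia).
  have [E|ny] := eqVneq v2 (y + 1).
    by move: (rN v1); rewrite -E vP => H; have := H ltac:(lia).
  lia.
(* The parent condition: the quadrant below and left of (x, y) holds (0, 0)
   but not (x, y).  On the sides of the rectangle convexity is enough. *)
move=> xy0; have [hx hy] := boxP _ _ xyP.
have [E|xn0] := eqVneq x 0.
  by right; rewrite E in xyP xy0 *; apply: (colP 0 0 (y - 1) y) => //; lia.
have [E|yn0] := eqVneq y 0.
  by left; rewrite E in xyP xy0 *; apply: (rowP 0 (x - 1) x 0) => //; lia.
have [lP|lN] := boolP ((x - 1, y) \in P); first by left.
have [bP|bN] := boolP ((x, y - 1) \in P); first by right.
have rN z : z < x -> (z, y) \notin P.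
  move=> xz; apply/negP => zP; case/negP: lN.
  by apply: (rowP z (x - 1) x) => //; lia.
have uN z : z < y -> (x, z) \notin P.
  move=> xz; apply/negP => zP; case/negP: bN.
  by apply: (colP x z (y - 1) y) => //; lia.
have := connected_closed (I := fun c => (c.1 < x) && (c.2 < y)) conP oP xyP.
move=> /=; suff cl : forall u v, u \in P -> v \in P -> adjacent u v ->
    (u.1 < x) && (u.2 < y) -> (v.1 < x) && (v.2 < y).
  by move=> /(_ cl); lia.
move=> [u1 u2] [v1 v2] _ vP; rewrite /adjacent /= => uv hu.
have [E|nx] := eqVneq v1 x.
  by move: (uN v2); rewrite -E vP => H; have := H ltac:(lia).
have [E|ny] := eqVneq v2 y.
  by move: (rN v1); rewrite -E vP => H; have := H ltac:(lia).
lia.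
Qed.

(** This is the global form of convexity: it contains row and column convexity
    and the contiguity of the antidiagonals.  By induction on the antidiagonals
    of the two cells, the one on the higher antidiagonal is replaced by a
    parent; either the rectangle becomes larger, or it loses one column (or row), which the corner
    condition restores cell by cell. *)
Lemma staircase_rectangle a b P : staircase a b P -> forall x1 y1 x2 y2 x y : int,
  (x1, y1) \in P -> (x2, y2) \in P -> x1 <= x <= x2 -> y2 <= y <= y1 ->
  (x, y) \in P.
Proof.
move=> sP x1 y1 x2 y2 x y; have [k] := ubnP (absz (x1 + y1 + x2 + y2)).
elim: k x1 y1 x2 y2 x y => // k IH x1 y1 x2 y2 x y hk P1 P2 hx hy.
have [bx1 by1] := stair_box sP P1; have [bx2 by2] := stair_box sP P2.
have [le|lt] := lerP (x1 + y1) (x2 + y2).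
  have [E|E] := eqVneq x1 x2; first by have -> : (x, y) = (x2, y2) by congr pair; lia.
  have [lP|dP] := stair_parent sP P2 ltac:(lia); last first.
    by apply: (IH _ _ _ _ _ _ _ P1 dP); lia.
  have [xx|xx] := eqVneq x x2; last by apply: (IH _ _ _ _ _ _ _ P1 lP); lia.
  rewrite xx {x hx xx}.
  have [j] : exists j : nat, y = y2 + j%:Z by exists (absz (y - y2)); lia.
  elim: j y hy => [|j IHj] y hy ey; first by rewrite ey addr0.
  have -> : (x2, y) = (x2 - 1 + 1, y - 1 + 1) by congr pair; lia.
  apply: (stair_corner sP); rewrite subrK; last by apply: IHj; lia.
  by apply: (IH _ _ _ _ _ _ _ P1 lP); lia.
have [E|E] := eqVneq y1 y2; first by lia.
have [lP|dP] := stair_parent sP P1 ltac:(lia).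
  by apply: (IH _ _ _ _ _ _ _ lP P2); lia.
have [yy|yy] := eqVneq y y1; last by apply: (IH _ _ _ _ _ _ _ dP P2); lia.
rewrite yy {y hy yy}.
have [j] : exists j : nat, x = x1 + j%:Z by exists (absz (x - x1)); lia.
elim: j x hx => [|j IHj] x hx ex; first by rewrite ex addr0.
have -> : (x, y1) = (x - 1 + 1, y1 - 1 + 1) by congr pair; lia.
apply: (stair_corner sP); rewrite subrK; first by apply: IHj; lia.
by apply: (IH _ _ _ _ _ _ _ dP P2); lia.
Qed.

Lemma adjacentC c d : adjacent c d = adjacent d c.
Proof. by rewrite /adjacent (distrC c.1) (distrC c.2). Qed.

Lemma staircase_connected a b P : staircase a b P -> connected P.
Proof.
move=> sP; have csym : connect_sym (fun u v : P => adjacent (val u) (val v)).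
  by apply: sym_connect_sym => u v; apply: adjacentC.
suff to0 (c : P) : connect (fun u v : P => adjacent (val u) (val v))
    c [` stair_bottom_left sP].
  by move=> c d; apply: (connect_trans (to0 c)); rewrite csym.
case: c => -[x y] xyP; have [k] := ubnP (absz (x + y)).
elim: k x y xyP => // k IH x y xyP hk.
have [hx hy] := stair_box sP xyP.
have [s0|s0] := lerP (x + y) 0.
  rewrite (_ : [` xyP] = [` stair_bottom_left sP]) ?connect0 //.
  by apply: val_inj; congr pair; lia.
by have [dP|dP] := stair_parent sP xyP s0;
  have [hx' hy'] := stair_box sP dP;
  (apply: connect_trans (IH _ _ dP _); last lia);
  apply: connect1; rewrite /adjacent /=; lia.
Qed.

Lemma mins_eq (s : seq int) x : x \in s -> (forall y, y \in s -> x <= y) ->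
  mins s = x.
Proof.
move=> xs lex; apply/eqP; rewrite eq_le mins_le //= lex //.
by apply: mins_mem; apply: contraTneq xs => ->.
Qed.

Lemma maxs_eq (s : seq int) x : x \in s -> (forall y, y \in s -> y <= x) ->
  maxs s = x.
Proof.
move=> xs gex; apply/eqP; rewrite eq_le maxs_ge // gex //.
by apply: maxs_mem; apply: contraTneq xs => ->.
Qed.

Lemma staircase_bounds a b P : staircase a b P ->
  [/\ xmin P = 0, ymin P = 0, xmax P = a & ymax P = b].
Proof.
move=> sP; split.
- apply: mins_eq; first by apply: (map_f fst (stair_bottom_left sP)).
  by move=> _ /mapP[[x y] /(stair_box sP)[hx hy] ->] /=; lia.
- apply: mins_eq; first by apply: (map_f snd (stair_bottom_left sP)).
  by move=> _ /mapP[[x y] /(stair_box sP)[hx hy] ->] /=; lia.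
- apply: maxs_eq; first by apply: (map_f fst (stair_top_right sP)).
  by move=> _ /mapP[[x y] /(stair_box sP)[hx hy] ->] /=; lia.
- apply: maxs_eq; first by apply: (map_f snd (stair_top_right sP)).
  by move=> _ /mapP[[x y] /(stair_box sP)[hx hy] ->] /=; lia.
Qed.

Lemma polyomino_of_staircase a b P : staircase a b P ->
  placed P /\ parallelogram_polyomino P.
Proof.
move=> sP; have [x0 y0 xa yb] := staircase_bounds sP.
split; first by split.
split; rewrite ?x0 ?y0 ?xa ?yb.
- by apply/fset0Pn; exists (0, 0); apply: stair_bottom_left sP.
- exact: staircase_connected sP.
- split=> [x1 x2 x3 y h12 h23 P1 P3|x y1 y2 y3 h12 h23 P1 P3].
    by apply: (staircase_rectangle sP P1 P3); lia.
  by apply: (staircase_rectangle sP P3 P1); lia.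
- exact: stair_bottom_left sP.
- exact: stair_top_right sP.
Qed.

(** * Gluing halves of symmetric sets *)

Definition glue (A : pred cell) (P Q : {fset cell}) : {fset cell} :=
  [fset c in P | A c] `|` [fset c in Q | ~~ A c].

Lemma mem_glue A P Q c : (c \in glue A P Q) = if A c then c \in P else c \in Q.
Proof. by rewrite !inE /=; case: (A c); rewrite ?andbT ?andbF ?orbF. Qed.

Section Glue.
Variables (A : pred cell) (s : cell -> cell).
Hypotheses (sK : involutive s) (A_cover : forall c, A c || A (s c)).

Definition overlap_agree (P Q : {fset cell}) : Prop :=
  forall c, A c -> A (s c) -> (c \in P) = (c \in Q).

Definition stable (P : {fset cell}) : Prop := forall c, c \in P -> s c \in P.

Lemma stable_mem P c : stable P -> (s c \in P) = (c \in P).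
Proof. by move=> iP; apply/idP/idP => /iP; rewrite ?sK. Qed.

(** The half and its image have equally many cells, cover the set, and meet in
    the overlap. *)
Lemma card_stable P : stable P ->
  (#|` P| + #|` [fset c in P | A c && A (s c)]| =
     #|` [fset c in P | A c]| + #|` [fset c in P | A c]|)%N.
Proof.
move=> iP; have imE : #|` [fset s x | x in [fset c in P | A c]]| = #|` [fset c in P | A c]|.
  by rewrite card_imfset //; exact: inv_inj.
have mem_im c :
    (c \in [fset s x | x in [fset c in P | A c]]) = (c \in P) && A (s c).
  apply/imfsetP/andP => [[d /=]|[cP Asc]].
    by rewrite !inE => /andP[/iP dP Ad] ->; rewrite sK.
  by exists (s c); rewrite /= ?sK // !inE iP.
rewrite -{1}imE -[RHS]cardfsUI; congr (_ + _)%N; congr #|` _|.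
  by apply/fsetP => c; rewrite inE mem_im !inE -andb_orr orbC A_cover andbT.
by apply/fsetP => c; rewrite inE mem_im !inE; case: (c \in P); rewrite //= andbC.
Qed.

(** Equal overlaps and equal cardinals force equal halves, by [card_stable]. *)
Lemma card_glue P Q : stable P -> stable Q -> overlap_agree P Q ->
  #|` P| = #|` Q| -> #|` glue A P Q| = #|` P|.
Proof.
move=> iP iQ agr ePQ.
have := card_stable iP; have := card_stable iQ.
have -> : [fset c in Q | A c && A (s c)] = [fset c in P | A c && A (s c)].
  apply/fsetP => c; rewrite !inE; case Ac: (A c); case Asc: (A (s c));
  by rewrite ?andbF //= agr.
have := cardfsUI [fset c in P | A c] [fset c in Q | ~~ A c].
have -> : [fset c in P | A c] `&` [fset c in Q | ~~ A c] = fset0.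
  by apply/fsetP => c; rewrite !inE; case: (A c); rewrite ?andbF.
rewrite cardfs0 -/(glue A P Q).
have := cardfsID [fset c in Q | A c] Q.
have -> : Q `&` [fset c in Q | A c] = [fset c in Q | A c].
  by apply/fsetP => c; rewrite !inE; case: (c \in Q).
have -> : Q `\` [fset c in Q | A c] = [fset c in Q | ~~ A c].
  by apply/fsetP => c; rewrite !inE; case: (c \in Q); rewrite /= ?andbT ?andbF.
by rewrite ePQ; lia.
Qed.

(** The glued set shows [P] on the half and [Q] off it; the agreement shows [Q]
    on the overlap too, hence on the whole image of the half, and stability
    recovers the rest of both sets. *)
Lemma glue_inj P Q P' Q' :
  stable P -> stable Q -> stable P' -> stable Q' ->
  overlap_agree P Q -> overlap_agree P' Q' ->
  glue A P Q = glue A P' Q' -> P = P' /\ Q = Q'.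
Proof.
move=> iP iQ iP' iQ' agr agr' /fsetP E.
have EA c : A c -> (c \in P) = (c \in P').
  by move=> Ac; have := E c; rewrite !mem_glue Ac.
have EQ c : A (s c) -> (c \in Q) = (c \in Q').
  move=> Asc; case Ac: (A c); first by rewrite -agr // -agr' // EA.
  by have := E c; rewrite !mem_glue Ac.
split; apply/fsetP => c; case/orP: (A_cover c) => Ac.
- exact: EA.
- by rewrite -(stable_mem c iP) -(stable_mem c iP') EA.
- by rewrite -(stable_mem c iQ) -(stable_mem c iQ') EQ ?sK.
- exact: EQ.
Qed.

Lemma glue_square (S F : {fset {fset cell}}) :
  {in S, forall P, stable P} ->
  {in S &, forall P Q, overlap_agree P Q /\ glue A P Q \in F} ->
  (#|` S| ^ 2 <= #|` F|)%N.
Proof.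
move=> iS SF; pose s2 := [seq glue A P Q | P <- S, Q <- S].
have <- : size s2 = (#|` S| ^ 2)%N by rewrite size_allpairs mulnn.
apply: uniq_leq_size => [|_ /allpairsP[[P Q] /= [PS QS ->]]]; last first.
  by have [] := SF _ _ PS QS.
apply: allpairs_uniq; rewrite ?fset_uniq // => -[P Q] [P' Q'].
move=> /allpairsP[[? ?] /= [PS QS [-> ->]]] /allpairsP[[? ?] /= [PS' QS' [-> ->]]].
move/glue_inj => /(_ (iS _ PS) (iS _ QS) (iS _ PS') (iS _ QS')).
by case/(_ (SF _ _ PS QS).1 (SF _ _ PS' QS').1) => -> ->.
Qed.
End Glue.

(** Covering a set by classes whose squared sizes are at most [M] bounds its own
    squared size, with a loss of only the square of the number of classes. *)
Lemma card_cover (T : choiceType) (I : finType) (S : {fset T})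
    (R : I -> T -> Prop) (M : nat) :
  {in S, forall x, exists i, R i x} ->
  (forall i, #|` [fset x in S | `[< R i x >]]| ^ 2 <= M)%N ->
  (#|` S| ^ 2 <= #|I| ^ 2 * M)%N.
Proof.
move=> cov bnd.
have [m mM mmax] : exists2 m, (m ^ 2 <= M)%N &
    forall i, (#|` [fset x in S | `[< R i x >]]| <= m)%N.
  exists (\max_i #|` [fset x in S | `[< R i x >]]|); last by move=> i; exact: leq_bigmax.
  have [/pred0P I0|] := boolP (pred0b I); first by rewrite big_pred0.
  case/pred0Pn => i0 _.
  have I0 : (0 < #|I|)%N by apply/card_gt0P; exists i0.
  have [j ->] := bigop.eq_bigmax (fun i => #|` [fset x in S | `[< R i x >]]|) I0.
  exact: bnd.
suff : (#|` S| <= #|I| * m)%N.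
  rewrite -leq_sqr expnMn => /leq_trans; apply.
  by rewrite leq_mul2l mM orbT.
apply: (@leq_trans (\sum_i #|` [fset x in S | `[< R i x >]]|)); last first.
  by rewrite -sum_nat_const; apply: leq_sum => i _.
have cardE i : #|` [fset x in S | `[< R i x >]]| = (\sum_(x <- S) `[< R i x >])%N.
  by rewrite card_fset_sum1 -big_fset_condE big_mkcond.
rewrite (eq_bigr _ (fun i _ => cardE i)) exchange_big /= card_fset_sum1.
rewrite big_seq [leqRHS]big_seq; apply: leq_sum => x /cov[i Rix].
by rewrite (bigD1 i) //= asboolT.
Qed.

(** * Gluing symmetric polyominoes *)

(** The image under a symmetry followed by the translation back into the
    rectangle: [None] stands for [r2], [Some true] for [d1] and [Some false]
    for [d2].  The two reflections force [a = b] (see [mirror_square]), so that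
    only [a] occurs in the formula for [d1]. *)
Definition mirror (g : option bool) (a b : int) (c : cell) : cell :=
  match g with
  | None => (a - c.1, b - c.2)
  | Some true => (a - c.2, a - c.1)
  | Some false => (c.2, c.1)
  end.

(** The constant [1] makes the half reach the antidiagonal just above the centre
    when [a + b] is odd, so that the half and its image overlap. *)
Definition lower_half (g : option bool) (a b : int) (c : cell) : bool :=
  if g == Some false then c.1 <= c.2 else 2 * (c.1 + c.2) <= a + b + 1.

Lemma mirrorK g a b : involutive (mirror g a b).
Proof. by case: g => [[]|] [x y] /=; rewrite ?subKr. Qed.

(** The last antidiagonal of the lower half for [r2] and [d1], where [x + y] is
    [(a + b) / 2] rounded up. *)
Definition middle (a b : int) (c : cell) : bool :=
  a + b <= 2 * (c.1 + c.2) <= a + b + 1.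

(** The data that two symmetric polyominoes must share to be glued: the
    rectangle and the cells on the middle antidiagonal, an interval encoded by
    its end columns. *)
Record symmetric_class (g : option bool) (a b l u : int) (P : {fset cell}) : Prop :=
  SymmetricClass {
    class_staircase : staircase a b P;
    class_stable : stable (mirror g a b) P;
    class_middle : forall c : cell, middle a b c -> (c \in P) = (l <= c.1 <= u) }.

Lemma mirror_square g a b P : staircase a b P -> stable (mirror g a b) P ->
  g != None -> a = b.
Proof.
move=> sP iP; have tP := iP _ (stair_top_right sP).
have oP := iP _ (stair_bottom_left sP).
by case: g oP tP {iP} => [[]|] //= /(stair_box sP) + /(stair_box sP); lia.
Qed.

Lemma lower_half_cover g a b P c : staircase a b P -> stable (mirror g a b) P ->
  lower_half g a b c || lower_half g a b (mirror g a b c).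
Proof.
move=> sP iP; have := mirror_square sP iP.
by case: g {iP} => [[]|] /=; rewrite /lower_half /=; [move=> /(_ isT)|move=> _|move=> _]; lia.
Qed.

(** Going down the diagonal, a parent of [(k + 1, k + 1)] and its mirror image
    are opposite corners of a square having [(k, k)] as its third corner.  So
    the overlap of the halves of a set symmetric under [d2] is always full. *)
Lemma mem_diagonal a P k : staircase a a P ->
  stable (mirror (Some false) a a) P -> 0 <= k <= a -> (k, k) \in P.
Proof.
move=> sP iP hk; have [j ej] : exists j : nat, k = a - j%:Z by exists (absz (a - k)); lia.
elim: j k hk ej => [|j IH] k hk ej; first by rewrite ej subr0; apply: stair_top_right sP.
have kP := IH (k + 1) ltac:(lia) ltac:(lia).
have := stair_parent sP kP ltac:(lia); rewrite addrK => -[] dP.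
  by apply: (staircase_rectangle sP dP (iP _ dP)) => /=; lia.
by apply: (staircase_rectangle sP (iP _ dP) dP) => /=; lia.
Qed.

(** For [r2] and [d1] the overlap is the middle antidiagonal and its mirror
    image, which coincide or are consecutive. *)
Lemma overlap_class g a b l u P Q :
  symmetric_class g a b l u P -> symmetric_class g a b l u Q ->
  overlap_agree (lower_half g a b) (mirror g a b) P Q.
Proof.
move=> [sP iP mP] [sQ iQ mQ] c.
have mid c' : middle a b c' -> (c' \in P) = (c' \in Q) by move=> mc; rewrite mP ?mQ.
have sq := mirror_square sP iP.
have [E|ng] := eqVneq g (Some false).
  rewrite {}E in iP iQ sq *; rewrite /lower_half /= => h1 h2.
  have ab := sq isT; rewrite -{}ab in sP sQ iP iQ.
  case: c h1 h2 => x y /= h1 h2; have -> : y = x by lia.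
  apply/idP/idP => [/(stair_box sP)|/(stair_box sQ)] [hx _].
    exact: mem_diagonal sQ iQ hx.
  exact: mem_diagonal sP iP hx.
rewrite /lower_half (negbTE ng) => h1 h2.
have [mc|nmc] := boolP (middle a b c); first exact: mid.
have mc : middle a b (mirror g a b c).
  move: nmc h1 h2 sq ng; rewrite /middle.
  by case: g {mP mQ mid iP iQ} => [[]|] //= + + + H; try have := H isT; lia.
rewrite -(stable_mem (mirrorK g a b) c iP) -(stable_mem (mirrorK g a b) c iQ).
exact: mid.
Qed.

(** The conditions on a staircase relate neighbouring cells, so they can only
    fail at the cut.  There [P] and [Q] agree: on the middle antidiagonal by
    assumption, and for [d2] on the diagonal because it is full in both. *)
Lemma glue_staircase g a b l u P Q :
  symmetric_class g a b l u P -> symmetric_class g a b l u Q ->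
  staircase a b (glue (lower_half g a b) P Q).
Proof.
move=> [sP iP mP] [sQ iQ mQ].
have mid c' : middle a b c' -> (c' \in P) = (c' \in Q) by move=> mc; rewrite mP ?mQ.
have sq := mirror_square sP iP.
have [a0 b0] := stair_box sP (stair_top_right sP).
have box x y : (x, y) \in glue (lower_half g a b) P Q -> 0 <= x <= a /\ 0 <= y <= b.
  by rewrite mem_glue; case: ifP => _ /stair_box; apply.
have bl : (0, 0) \in glue (lower_half g a b) P Q.
  by rewrite mem_glue (stair_bottom_left sP) (stair_bottom_left sQ) if_same.
have tr : (a, b) \in glue (lower_half g a b) P Q.
  by rewrite mem_glue (stair_top_right sP) (stair_top_right sQ) if_same.
have [E|ng] := eqVneq g (Some false).
  rewrite {}E in iP iQ sq box bl tr *; have ab := sq isT.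
  rewrite -{}ab in sP sQ iP iQ box bl tr *.
  have memE x y : ((x, y) \in glue (lower_half (Some false) a a) P Q) =
      if x <= y then (x, y) \in P else (x, y) \in Q by rewrite mem_glue.
  split=> // x y; rewrite !memE.
    have [le|lt] := lerP x y => xyP pos.
      have := stair_parent sP xyP pos.
      have [E|ne] := eqVneq x y; last by rewrite !ifT //; lia.
      by subst y; move=> H; left; rewrite ifT; [case: H => // /iP|lia].
    have := stair_parent sQ xyP pos.
    have [E|ne] := eqVneq (x - 1) y; last by rewrite !ifF //; lia.
    have [hx hy] := stair_box sQ xyP.
    by rewrite E lexx => _; left; apply: (mem_diagonal sP iP); lia.
  have [E|ne] := eqVneq x y.
    subst y; rewrite lexx ifT 1?ifF; [|lia..] => xP _.
    have [hx hy] := stair_box sP xP.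
    by apply: (mem_diagonal sP iP); lia.
  have [le|lt] := lerP x y.
    by rewrite !ifT; [exact: (stair_corner sP)|lia..].
  have [E|ne'] := eqVneq x (y + 1); last first.
    by rewrite !ifF; [exact: (stair_corner sQ)|lia..].
  rewrite -E lexx !ifF; [|lia..] => /(stair_box sP)[hx _] xQ.
  rewrite {2}E; apply: (stair_corner sQ) => //; rewrite -E.
  exact: (mem_diagonal sQ iQ).
have memE x y : ((x, y) \in glue (lower_half g a b) P Q) =
    if 2 * (x + y) <= a + b + 1 then (x, y) \in P else (x, y) \in Q.
  by rewrite mem_glue /lower_half (negbTE ng).
split=> // x y; rewrite !memE.
  case: ifP => h xyP pos.
    by have := stair_parent sP xyP pos; rewrite !ifT //; lia.
  have := stair_parent sQ xyP pos.
  have -> : x - 1 + y = x + y - 1 by lia.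
  have -> : x + (y - 1) = x + y - 1 by lia.
  by case: ifP => // h'; rewrite !mid // /middle /=; lia.
have -> : x + 1 + y = x + (y + 1) by lia.
have [h|h] := lerP (2 * (x + (y + 1))) (a + b + 1); last first.
  by rewrite ifF; [exact: (stair_corner sQ)|lia].
case: ifP => h'; first exact: (stair_corner sP).
by rewrite !mid /middle /=; [exact: (stair_corner sQ)|lia..].
Qed.

(** * Counting symmetric polyominoes *)

Lemma translates_image (f : cell -> cell) P : translates P [fset f c | c in P] ->
  exists v : int * int,
    (forall c, c \in P -> ((f c).1 - v.1, (f c).2 - v.2) \in P) /\
    (forall c, c \in P -> exists2 d, d \in P & f d = (c.1 + v.1, c.2 + v.2)).
Proof.
move=> [v E]; exists v; split=> c cP.
  by rewrite -mem_translate -E; apply: in_imfset.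
have : ((c.1 + v.1, c.2 + v.2) : cell) \in translate v P.
  by rewrite mem_translate /= !addrK -surjective_pairing.
by rewrite -E => /imfsetP[d /= dP ->]; exists d.
Qed.

(** The translation vector is forced: the corners of the rectangle go to corners
    of the bounding rectangle of the image. *)
Lemma symmetric_stable a b P : staircase a b P -> ~ asymmetric P ->
  exists g, stable (mirror g a b) P.
Proof.
move=> sP; have bl := stair_bottom_left sP; have tr := stair_top_right sP.
have bx := stair_box sP.
move=> nas; apply: contra_notP nas => /forallNP nst.
split=> /translates_image[v [im pre]].
- apply: (nst None) => -[x y] xyP.
  have [[x0 y0] /bx + [e1 e2]] := pre _ bl; have := bx _ _ (im _ tr).
  move=> /= ? ?; rewrite /= (_ : (_, _) = (- x - v.1, - y - v.2)); first exact: im xyP.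
  by congr pair; lia.
- apply: (nst (Some true)) => -[x y] xyP.
  have [[x0 y0] /bx + [e1 e2]] := pre _ bl; have := bx _ _ (im _ tr).
  have := bx _ _ (im _ bl).
  move=> /= ? ? ?; rewrite /= (_ : (_, _) = (- y - v.1, - x - v.2)); first exact: im xyP.
  by congr pair; lia.
- apply: (nst (Some false)) => -[x y] xyP.
  have [[x0 y0] /bx + [e1 e2]] := pre _ bl; have := bx _ _ (im _ bl).
  move=> /= ? ?; rewrite /= (_ : (_, _) = (y - v.1, x - v.2)); first exact: im xyP.
  by congr pair; lia.
Qed.

Lemma symmetric_class_exists a b n P : staircase a b P -> a < n%:Z -> b < n%:Z -> 
  ~ asymmetric P -> exists i : option bool * 'I_n.+1 * 'I_n.+1 * 'I_n.+1 * 'I_n.+1,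
    symmetric_class i.1.1.1.1 i.1.1.1.2 i.1.1.2 i.1.2 i.2 P.
Proof.
move=> sP an bn nas; have [g iP] := symmetric_stable sP nas.
have [/andP[a0 _] /andP[b0 _]] := stair_box sP (stair_top_right sP).
have [l [u [ln un lu]]] : exists l u : nat, [/\ (l < n.+1)%N, (u < n.+1)%N &
    forall c : cell, middle a b c -> (c \in P) = ((l%:Z <= c.1) && (c.1 <= u%:Z))].
  pose s := [seq c.1 | c <- P & middle a b c].
  have memS c : c \in P -> middle a b c -> c.1 \in s.
    by move=> cP mc; apply: map_f; rewrite mem_filter mc.
  have [s0|sn0] := eqVneq s [::].
    (* The endpoints 1 and 0 encode the empty interval. *)
    exists 1%N, 0%N; split; try lia; move=> c mc.
    rewrite [RHS](_ : _ = false); last lia.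
    by apply: contraTF isT => /memS/(_ mc); rewrite s0.
  have /mapP[[l y1]] := mins_mem sn0; rewrite mem_filter => /andP[ml lP] /= el.
  have /mapP[[u y2]] := maxs_mem sn0; rewrite mem_filter => /andP[mu uP] /= eu.
  have [hl _] := stair_box sP lP; have [hu _] := stair_box sP uP.
  exists (absz l), (absz u); split; try lia; move=> [x y] mc /=.
  have -> : (absz l)%:Z = l by lia.
  have -> : (absz u)%:Z = u by lia.
  apply/idP/idP => [xyP|hx]; first by rewrite -el -eu mins_le ?maxs_ge ?(memS (x, y)).
  move: ml mu mc; rewrite /middle /= => ml mu mc.
  by apply: (staircase_rectangle sP lP uP); lia.
have aE : (absz a)%:Z = a by lia.
have bE : (absz b)%:Z = b by lia.
have an' : (absz a < n.+1)%N by lia.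
have bn' : (absz b < n.+1)%N by lia.
exists (g, Ordinal an', Ordinal bn', Ordinal ln, Ordinal un) => /=.
by rewrite aE bE; split.
Qed.

(** Both counts are treated at once: [true] selects the half-perimeter and
    [false] the area. *)
Definition extent (h : bool) : {fset cell} -> nat :=
  if h then half_perimeter else area.

Definition polyominoes (h : bool) (n : nat) : {fset {fset cell}} :=
  [fset P in fpowerset (box n) | `[< placed P /\
     (parallelogram_polyomino P /\ extent h P = n) >]].

Definition asym_polyominoes (h : bool) (n : nat) : {fset {fset cell}} :=
  [fset P in fpowerset (box n) | `[< placed P /\
     [/\ parallelogram_polyomino P, asymmetric P & extent h P = n] >]].

Lemma polyominoesP h n P :
  reflect ((exists a b, staircase a b P) /\ extent h P = n) (P \in polyominoes h n).
Proof.
rewrite !inE; apply: (iffP andP) => [[_ /asboolP[pP [ppP eP]]]|[[a [b sP]] eP]].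
  by split=> //; exists (xmax P), (ymax P); apply: staircase_of_polyomino.
have [pP ppP] := polyomino_of_staircase sP; split; last by apply/asboolP.
rewrite fpowersetE; case: h eP => eP; first exact: half_perimeter_box.
exact: area_box.
Qed.

Lemma staircase_half_perimeter a b P : staircase a b P ->
  half_perimeter P = absz (a + b + 2).
Proof.
move=> sP; have [x0 y0 xa yb] := staircase_bounds sP.
by rewrite /half_perimeter /width /height x0 y0 xa yb; congr absz; lia.
Qed.

Lemma class_glue h n g a b l u P Q :
  symmetric_class g a b l u P -> symmetric_class g a b l u Q ->
  extent h P = n -> extent h Q = n -> 
  glue (lower_half g a b) P Q \in polyominoes h n.
Proof.
move=> cP cQ eP eQ; have sG := glue_staircase cP cQ.
apply/polyominoesP; split; first by exists a, b.
case: h eP eQ => /=; first by rewrite (staircase_half_perimeter (class_staircase cP))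
  (staircase_half_perimeter sG).
rewrite /area => eP eQ; rewrite -[RHS]eP.
apply: (card_glue (mirrorK g a b)) => [c||||].
- exact: lower_half_cover (class_staircase cP) (class_stable cP).
- exact: class_stable cP.
- exact: class_stable cQ.
- exact: overlap_class cP cQ.
- by rewrite eP eQ.
Qed.

(** The factor [3 (n + 1)^4] counts the classes: three symmetries, and four
    coordinates of the rectangle and of the middle antidiagonal. *)
Lemma symmetric_square h n :
  (#|` polyominoes h n `\` asym_polyominoes h n| ^ 2 <=
     (3 * n.+1 ^ 4) ^ 2 * #|` polyominoes h n|)%N.
Proof.
pose I := (option bool * 'I_n.+1 * 'I_n.+1 * 'I_n.+1 * 'I_n.+1)%type.
have <- : #|{: I}| = (3 * n.+1 ^ 4)%N.
  by rewrite !card_prod card_option card_bool card_ord; lia.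
apply: (@card_cover _ _ _
  (fun i : I => symmetric_class i.1.1.1.1 i.1.1.1.2 i.1.1.2 i.1.2 i.2)).
  move=> P; rewrite inE => /andP[nasP PF].
  have /polyominoesP[[a [b sP]] eP] := PF.
  have /fsubsetP/(_ _ (stair_top_right sP)) : P `<=` box n.
    by move: PF; rewrite !inE fpowersetE => /andP[].
  move=> /imfset2P[x /=]; rewrite mem_iota => hx [y /=]; rewrite mem_iota => hy [ax bY].
  apply: (symmetric_class_exists sP); [lia|lia|] => asP.
  case/negP: nasP; move: PF; rewrite !inE => /andP[-> /asboolP[pP [ppP _]]].
  by apply/asboolP.
move=> [[[[g a] b] l] u] /=; set S := [fset P in _ | _].
have SP P : P \in S -> symmetric_class g a b l u P /\ extent h P = n.
  rewrite !inE /= => /andP[/andP[_ /andP[_ /asboolP[_ [_ eP]]]] /asboolP cP].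
  by split.
have [->|/fset0Pn[P0 /SP[c0 _]]] := eqVneq S fset0; first by rewrite cardfs0.
apply: (glue_square (mirrorK g a b)).
- by move=> c; exact: (lower_half_cover c (class_staircase c0) (class_stable c0)).
- by move=> P /SP[cP _]; apply: class_stable cP.
move=> P Q /SP[cP eP] /SP[cQ eQ]; split; first exact: overlap_class cP cQ.
exact: class_glue cP cQ eP eQ.
Qed.

(** * Exponential growth *)

Lemma staircase_grow a b P (d : bool) : staircase a b P ->
  staircase (a + d%:Z) (b + (~~ d)%:Z) ((a + d%:Z, b + (~~ d)%:Z) |` P).
Proof.
move=> sP; have bx := stair_box sP; have tr := stair_top_right sP.
have [/andP[a0 _] /andP[b0 _]] := bx _ _ tr.
have memE x y : ((x, y) \in ((a + d%:Z, b + (~~ d)%:Z) : cell) |` P) =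
    (x == a + d%:Z) && (y == b + (~~ d)%:Z) || ((x, y) \in P).
  by rewrite !inE xpair_eqE.
split=> [x y|||x y|x y]; rewrite !memE.
- by case/orP => [|/bx]; case: d {memE} => /=; lia.
- by rewrite (stair_bottom_left sP) orbT.
- by rewrite !eqxx.
- case/orP => [/andP[/eqP-> /eqP->]|xyP] pos.
    by case: d {memE pos} => /=; [left|right]; rewrite addr0 addrK tr orbT.
  by have [->|->] := stair_parent sP xyP pos; rewrite !orbT; [left|right].
case/orP => [e1|P1] /orP[e2|P2].
- by case: d e1 e2 {memE} => /=; lia.
- by have := bx _ _ P2; case: d e1 {memE} => /=; lia.
- by have := bx _ _ P1; case: d e2 {memE} => /=; lia.
- by rewrite (stair_corner sP P1 P2) orbT.
Qed.

Definition grow (d : bool) (P : {fset cell}) : {fset cell} :=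
  ((xmax P + d%:Z, ymax P + (~~ d)%:Z) : cell) |` P.

Lemma polyominoes_grow h n d P :
  P \in polyominoes h n -> grow d P \in polyominoes h n.+1.
Proof.
move=> /polyominoesP[[a [b sP]] eP]; have sG := staircase_grow d sP.
have [_ _ xa yb] := staircase_bounds sP; rewrite /grow xa yb.
apply/polyominoesP; split; first by exists (a + d%:Z), (b + (~~ d)%:Z).
have [/andP[a0 _] /andP[b0 _]] := stair_box sP (stair_top_right sP).
case: h eP; rewrite /= ?(staircase_half_perimeter sP) ?(staircase_half_perimeter sG).
  by case: d {sG}; lia.
rewrite /area => eP; rewrite cardfsU1 eP (_ : _ \notin P) //.
by apply/negP => /(stair_box sP); case: d {sG}; lia.
Qed.

(** The attached cell is the top-right cell of the result; removing it gives
    [P] back, and its position relative to the rectangle of [P] gives [d]. *)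
Lemma grow_inj h n : {in polyominoes h n &, forall P Q d e,
  grow d P = grow e Q -> d = e /\ P = Q}.
Proof.
move=> P Q /polyominoesP[[a [b sP]] _] /polyominoesP[[a' [b' sQ]] _] d e.
have [_ _ xa yb] := staircase_bounds sP; have [_ _ xa' yb'] := staircase_bounds sQ.
rewrite /grow xa yb xa' yb' => E.
have [_ _ xG yG] := staircase_bounds (staircase_grow d sP).
have [_ _ xG' yG'] := staircase_bounds (staircase_grow e sQ).
rewrite E xG' yG' in xG yG.
have notP : (a + d%:Z, b + (~~ d)%:Z) \notin P.
  by apply/negP => /(stair_box sP); case: (d); lia.
have notQ : (a' + e%:Z, b' + (~~ e)%:Z) \notin Q.
  by apply/negP => /(stair_box sQ); case: (e); lia.
have PQ : P = Q.
  by rewrite -(fsetU1K notP) -(fsetU1K notQ) E xG yG.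
split=> //; move: xa xa' xG; rewrite PQ => -> ->.
by case: (d) (e) => [] []; lia.
Qed.

Lemma polyominoes_double h n :
  (2 * #|` polyominoes h n| <= #|` polyominoes h n.+1|)%N.
Proof.
pose s := [seq grow d P | d <- [:: true; false], P <- polyominoes h n].
have <- : size s = (2 * #|` polyominoes h n|)%N by rewrite size_allpairs.
apply: uniq_leq_size => [|_ /allpairsP[[d P] /= [_ PS ->]]]; last first.
  exact: polyominoes_grow.
apply: allpairs_uniq; rewrite ?fset_uniq // => -[d P] [e Q].
move=> /allpairsP[[? ?] [_ PS [-> ->]]] /allpairsP[[? ?] [_ QS [-> ->]]].
by rewrite /= => /(grow_inj PS QS)[/= -> ->].
Qed.

(** The single cell has extent [h.+1], and is doubled [k] times. *)
Lemma polyominoes_lower h k : (2 ^ k <= #|` polyominoes h (k + h.+1)|)%N.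
Proof.
elim: k => [|k IH]; last first.
  by rewrite expnS addSn (leq_trans _ (polyominoes_double _ _)) // leq_mul2l.
rewrite cardfs_gt0; apply/fset0Pn; exists [fset (0, 0) : cell].
have s1 : staircase 0 0 [fset (0, 0) : cell].
  by split=> [x y|||x y|x y]; rewrite ?inE ?xpair_eqE; lia.
apply/polyominoesP; split; first by exists 0, 0.
by case: h; rewrite /= ?(staircase_half_perimeter s1) // /area cardfs1.
Qed.

(** * The limits *)

(** From [n + 1 <= k (n / k + 1) <= k 2 ^ (n / k)]. *)
Lemma expn_dominates k n : (0 < k)%N -> (n.+1 ^ k <= k ^ k * 2 ^ n)%N.
Proof.
move=> k0; have nk : (n.+1 <= k * 2 ^ (n %/ k))%N.
  apply: (leq_trans (ltn_ceil n k0)).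
  by rewrite mulnC leq_mul2l ltn_expl ?orbT.
apply: (@leq_trans ((k * 2 ^ (n %/ k)) ^ k)%N); first by rewrite leq_exp2r.
by rewrite expnMn -expnM leq_mul2l leq_exp2l // leq_trunc_div orbT.
Qed.

Lemma asym_polyominoes_sub h n :
  (asym_polyominoes h n `<=` polyominoes h n)%fset.
Proof.
apply/fsubsetP => P; rewrite !inE => /andP[-> /asboolP[pP [ppP _ eP]]].
by apply/asboolP.
Qed.

(** With [n.+1 ^ 4] in place of [n.+1], the square of the inequality follows
    from [s^2 <= 9 (n + 1)^8 p], [(n + 1)^16 <= 16^16 2^n] and [2^n <= 4 p]. *)
Lemma symmetric_rare h : exists K, forall n, (2 <= n)%N ->
  ((#|` polyominoes h n| - #|` asym_polyominoes h n|) * n.+1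
     <= K * #|` polyominoes h n|)%N.
Proof.
exists (6 * 16 ^ 8)%N => n n2; rewrite -(cardfsDS (asym_polyominoes_sub h n)).
have sq := symmetric_square h n.
have hn : (h.+1 <= n)%N by case: (h); lia.
have low : (2 ^ n <= 4 * #|` polyominoes h n|)%N.
  have := polyominoes_lower h (n - h.+1); rewrite subnK // => low.
  rewrite -[in leqLHS](subnK hn) expnD mulnC.
  by apply: (leq_mul _ low); case: (h).
have pow := expn_dominates n (isT : (0 < 16)%N).
rewrite -leq_sqr; set s := #|` _ `\` _| in sq *; set p := #|` _| in sq low *.
apply: (@leq_trans ((s * n.+1 ^ 4) ^ 2)%N).
  by rewrite leq_sqr leq_mul2l (@leq_pexp2l n.+1 1 4) ?orbT.
have -> : ((6 * 16 ^ 8 * p) ^ 2 = 9 * p * (16 ^ 16 * (4 * p)))%N.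
  by rewrite (expnM 16 8 2 : (16 ^ 16)%N = _); move: (16 ^ 8)%N => X; lia.
apply: (@leq_trans (9 * p * n.+1 ^ 16)%N).
  rewrite expnMn (expnM n.+1 4 4 : (n.+1 ^ 16)%N = _).
  by apply: (leq_trans (leq_mul sq (leqnn _))); lia.
by rewrite leq_mul2l (leq_trans pow) ?orbT // leq_mul2l low orbT.
Qed.

Local Open Scope classical_set_scope.

Theorem proposition15 (R : realType) :
  ((asym_p_area n)%:R / (p_area n)%:R : R) @[n --> \oo] --> (1 : R) /\
  ((asym_p_half_perimeter n)%:R / (p_half_perimeter n)%:R : R)
    @[n --> \oo] --> (1 : R).
Proof.
suff H h : ((#|` asym_polyominoes h n|)%:R / (#|` polyominoes h n|)%:R : R)
    @[n --> \oo] --> (1 : R) by split; [exact: (H false)|exact: (H true)].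
have [K rare] := symmetric_rare h.
apply: (@squeeze_cvgr _ _ _ _ (fun n => 1 - K%:R * harmonic n) (fun=> 1)).
- near=> n; set p := #|` polyominoes h n|; set q := #|` asym_polyominoes h n|.
  have n2 : (2 <= n)%N by near: n; exists 2%N.
  have p0 : (0 < p%:R :> R).
    rewrite ltr0n; have := polyominoes_lower h (n - h.+1); rewrite subnK; last by case: (h); lia.
    by apply: leq_trans; rewrite expn_gt0.
  have qp : (q <= p)%N by exact/fsubset_leq_card/asym_polyominoes_sub.
  apply/andP; split; last by rewrite ler_pdivrMr // mul1r ler_nat.
  rewrite ler_pdivlMr // mulrBl mul1r lerBlDr -lerBlDl -natrB //.
  rewrite mulrAC ler_pdivlMr ?ltr0Sn // -!natrM ler_nat.
  exact: rare.
- rewrite -[X in _ --> X]subr0 -(mulr0 K%:R).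
  by apply: cvgB; [exact: cvg_cst|apply: cvgMr; exact: cvg_harmonic].
- exact: cvg_cst.
Unshelve. all: by end_near.
Qed.
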